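(* Let $G$ be a group. Then $G$ is the union of two proper subsemigroups if and only if $G$ has a nontrivial left-orderable quotient, i.e. if and only if there exists a normal subgroup $N \unlhd G$ such that the quotient group $G/N$ is nontrivial and left-orderable.
   Context: A subsemigroup of a group $G$ is a subset of $G$ closed under the multiplication of $G$ (it need not contain the identity or inverses); it is proper if it is not equal to $G$. A group $G$ is left-orderable if there is a total order $\leq$ on $G$ such that for all $g_1,g_2,h\in G$: $g_1\leq g_2$ if and only if $hg_1\leq hg_2$. *)

(* Defs.v *)
From HB Require Import structures.
From mathcomp Require Import all_boot.
From mathcomp Require Import boolp classical_sets.

Set Implicit Arguments.
Unset Strict Implicit.
Unset Printing Implicit Defensive.

Local Open Scope group_scope.
Local Open Scope quotient_scope.
Local Open Scope classical_set_scope.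

(* The empty set is allowed, and neither 1 nor inverses are required. *)
Definition subsemigroup (G : groupType) (S : set G) : Prop :=
  forall x y : G, S x -> S y -> S (x * y).

Record normal_subgroup (G : groupType) := NormalSubgroup {
  normal_subgroup_set : set G;
  normal_subgroup1 : normal_subgroup_set 1;
  normal_subgroupM : forall x y : G, normal_subgroup_set x ->
    normal_subgroup_set y -> normal_subgroup_set (x * y);
  normal_subgroupV : forall x : G, normal_subgroup_set x ->
    normal_subgroup_set x^-1;
  normal_subgroupJ : forall x g : G, normal_subgroup_set x ->
    normal_subgroup_set (g * x * g^-1)
}.

Section QuotientGroup.
Variables (G : groupType) (N : normal_subgroup G).
Implicit Types x y z : G.

(* x N = y N *)
Definition same_coset : rel G := fun x y => `[< normal_subgroup_set N (x^-1 * y) >].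

Lemma same_coset_refl : reflexive same_coset.
Proof. by move=> x; apply/asboolP; rewrite mulVg; apply: normal_subgroup1. Qed.

Lemma same_coset_sym : symmetric same_coset.
Proof.
suff H x y : same_coset x y -> same_coset y x by move=> x y; apply/idP/idP => /H.
move=> /asboolP /normal_subgroupV; rewrite invgM invgK => Nyx.
exact/asboolP.
Qed.

Lemma same_coset_trans : transitive same_coset.
Proof.
move=> y x z /asboolP Nxy /asboolP Nyz; apply/asboolP.
have := normal_subgroupM Nxy Nyz.
by rewrite mulgA -(mulgA x^-1) mulgV mulg1.
Qed.

Canonical same_coset_equiv :=
  EquivRel same_coset same_coset_refl same_coset_sym same_coset_trans.

Definition quotient_group := {eq_quot same_coset}.

HB.instance Definition _ := Choice.on quotient_group.
HB.instance Definition _ := EqQuotient.on quotient_group.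

Lemma same_cosetP x y :
  reflect (\pi_quotient_group x = \pi_quotient_group y) (same_coset x y).
Proof. exact: (iffP (@eqmodP _ same_coset_equiv x y)). Qed.

Definition quotient_one : quotient_group := \pi_quotient_group 1.
Definition quotient_inv (a : quotient_group) : quotient_group :=
  \pi_quotient_group (repr a)^-1.
Definition quotient_mul (a b : quotient_group) : quotient_group :=
  \pi_quotient_group (repr a * repr b).

Lemma quotient_mulE x y :
  quotient_mul (\pi_quotient_group x) (\pi_quotient_group y)
    = \pi_quotient_group (x * y).
Proof.
rewrite /quotient_mul; case: piP => x' /same_cosetP/asboolP Nx.
case: piP => y' /same_cosetP/asboolP Ny.
apply/esym/same_cosetP/asboolP.
have := normal_subgroupM (normal_subgroupJ y^-1 Nx) Ny.
by rewrite invgK invgM !mulgA mulgK.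
Qed.

Lemma quotient_invE x :
  quotient_inv (\pi_quotient_group x) = \pi_quotient_group x^-1.
Proof.
rewrite /quotient_inv; case: piP => x' /same_cosetP/asboolP Nx.
apply/same_cosetP/asboolP; rewrite invgK.
have := normal_subgroupJ x Nx.
by rewrite mulgA mulgV mul1g.
Qed.

Lemma quotient_mulA : associative quotient_mul.
Proof.
elim/quotW=> x; elim/quotW=> y; elim/quotW=> z.
by rewrite (quotient_mulE y z) (quotient_mulE x y) !quotient_mulE mulgA.
Qed.

Lemma quotient_mul1 : left_id quotient_one quotient_mul.
Proof. by elim/quotW=> x; rewrite quotient_mulE mul1g. Qed.

Lemma quotient_mulr1 : right_id quotient_one quotient_mul.
Proof. by elim/quotW=> x; rewrite quotient_mulE mulg1. Qed.

Lemma quotient_mulV : left_inverse quotient_one quotient_inv quotient_mul.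
Proof. by elim/quotW=> x; rewrite quotient_invE quotient_mulE mulVg. Qed.

Lemma quotient_mulrV : right_inverse quotient_one quotient_inv quotient_mul.
Proof. by elim/quotW=> x; rewrite quotient_invE quotient_mulE mulgV. Qed.

HB.instance Definition _ := isGroup.Build quotient_group
  quotient_mulA quotient_mul1 quotient_mulr1 quotient_mulV quotient_mulrV.

End QuotientGroup.

Definition nontrivial (G : groupType) : Prop := exists x : G, x <> 1.

Definition left_orderable (G : groupType) : Prop :=
  exists le : rel G,
    [/\ reflexive le, antisymmetric le, transitive le, total le
      & forall g1 g2 h : G, le g1 g2 <-> le (h * g1) (h * g2)].

(* Main.v *)
(** If [G = A ∪ B] with [A], [B] proper, then [P ∪ P^-1 = G] for [P = A] or
    [P = B]: if [g, g^-1] avoid [A] and [h, h^-1] avoid [B], then [g, g^-1] lie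
    in [B] and [h, h^-1] in [A], and [gh] belongs to neither.  Such a [P] is the
    same as a total left-invariant preorder [x ≤ y <-> x^-1 y ∈ P], so [G] acts
    on the totally ordered cosets of the proper subgroup [P ∩ P^-1].  The
    kernel [N] of this action is proper, and well-ordering the points makes
    [G/N] left-orderable: [g] is positive when it moves up the first point that
    it moves.  Conversely, the nonnegative and the nonpositive elements of a
    nontrivial left-ordered quotient pull back to two proper subsemigroups
    covering [G]. *)

Require Import Defs.
From mathcomp Require Import all_boot.
From mathcomp Require Import boolp classical_sets wochoice.

Local Open Scope classical_set_scope.

Section GroupScope.
Set Implicit Arguments.
Unset Strict Implicit.
Unset Printing Implicit Defensive.
Local Open Scope group_scope.
Local Open Scope quotient_scope.

Lemma exists_strict_well_order (T : eqType) :
  exists lt : T -> T -> Prop,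
    [/\ well_founded lt, (forall x y z, lt x y -> lt y z -> lt x z)
      & forall x y, [\/ lt x y, x = y | lt y x]].
Proof.
have [R Rwo] := well_ordering_principle T.
pose lt x y : Prop := ~~ R y x.
have lt_wf : well_founded lt.
  move=> x; apply: contrapT => nAx.
  have [] := Rwo [pred y | `[< ~ Acc lt y >]]; first by exists x; apply/asboolP.
  move=> z [[/asboolP nAz zmin] _]; apply: nAz; constructor => y.
  by apply: contraNP => nAy; apply: zmin; apply/asboolP.
have lt3 x y : [\/ lt x y, x = y | lt y x].
  case: (boolP (R y x)) => [Ryx|]; last by constructor 1.
  case: (boolP (R x y)) => [Rxy|]; last by constructor 3.
  constructor 2; apply: (wo_chain_antisymmetric (C := predT) (R := R)) => //.
    by move=> A _; apply: Rwo.
  by rewrite Rxy Ryx.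
(* Well-foundedness excludes cycles of length 2 and 3; with trichotomy this yields transitivity. *)
have no_cycle2 x y : lt x y -> lt y x -> False.
  by elim/(well_founded_ind lt_wf): x y => x IH y xy yx; apply: (IH y yx x).
have no_cycle3 x y z : lt x y -> lt y z -> lt z x -> False.
  elim/(well_founded_ind lt_wf): x y z => x IH y z xy yz zx.
  exact: (IH z zx x y).
exists lt; split=> // x y z xy yz; case: (lt3 x z) => // [xz|zx].
  by case: (no_cycle2 x y xy); rewrite xz.
by case: (no_cycle3 x y z xy yz zx).
Qed.

Definition units (G : groupType) (P : set G) : set G :=
  [set x | P x /\ P x^-1].

(** The intersection of the conjugates of [units P]: the kernel of the action on its cosets when
    [units P] is a subgroup. *)
Definition unit_core (G : groupType) (P : set G) : set G :=
  [set g | forall x, units P (g ^ x)].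

(* [x <= y <-> P (x^-1 * y)] is a left-invariant preorder, in which [g] fixes
   the class of [x] iff [units P (g ^ x)], and [x <= g * x] iff [P (g ^ x)]. *)
Definition lex_cone (G : groupType) (lt : G -> G -> Prop) (P : set G) : set G :=
  [set g | forall x, (forall y, lt y x -> units P (g ^ y)) -> P (g ^ x)].

Lemma total_subsemigroup1 (G : groupType) (P : set G) :
  (forall x, P x \/ P x^-1) -> P 1.
Proof. by case/(_ 1); rewrite ?invg1. Qed.

Lemma unitsM (G : groupType) (P : set G) (x y : G) :
  subsemigroup P -> units P x -> units P y -> units P (x * y).
Proof.
move=> Pmul [Px Pxi] [Py Pyi]; split; first exact: Pmul.
by rewrite invgM; apply: Pmul.
Qed.

Lemma unitsV (G : groupType) (P : set G) (x : G) :
  units P x -> units P x^-1.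
Proof. by rewrite /units /= invgK => -[]. Qed.

(** Here [x^-1] is [y * (x * y)^-1] and [y^-1] is [(x * y)^-1 * x]. *)
Lemma units_mul_factors (G : groupType) (P : set G) (x y : G) :
  subsemigroup P -> P x -> P y -> units P (x * y) -> units P x /\ units P y.
Proof.
move=> Pmul Px Py [_ Pxy]; do 2![split=> //].
  by have := Pmul _ _ Py Pxy; rewrite invgM mulVKg.
by have := Pmul _ _ Pxy Px; rewrite invgM mulgVK.
Qed.

(** If [g * h] fixes all points below [x], then by induction along [lt] so do [g] and [h]: neither
    moves the next point down, and their product fixes it. *)
Lemma lex_coneM (G : groupType) (lt : G -> G -> Prop) (P : set G) :
  well_founded lt -> (forall x y z, lt x y -> lt y z -> lt x z) ->
  subsemigroup P -> subsemigroup (lex_cone lt P).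
Proof.
move=> lt_wf lt_trans Pmul g h Qg Qh x fix_gh.
have fix_g_h y : lt y x -> units P (g ^ y) /\ units P (h ^ y).
  elim/(well_founded_ind lt_wf): y => y IH yx.
  have fix_below z : lt z y -> units P (g ^ z) /\ units P (h ^ z).
    by move=> zy; apply: IH => //; apply: lt_trans yx.
  apply: units_mul_factors => //; last by rewrite -conjMg; apply: fix_gh.
    by apply: Qg => z /fix_below[].
  by apply: Qh => z /fix_below[].
rewrite conjMg; apply: Pmul; first by apply: Qg => y /fix_g_h[].
by apply: Qh => y /fix_g_h[].
Qed.

Lemma lex_cone_total (G : groupType) (lt : G -> G -> Prop) (P : set G) :
  (forall x y, [\/ lt x y, x = y | lt y x]) -> (forall x, P x \/ P x^-1) ->
  forall g, lex_cone lt P g \/ lex_cone lt P g^-1.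
Proof.
move=> lt3 Ptot g; case: (pselect (lex_cone lt P g)) => [|nQg]; [by left|right].
move=> z fixVz; apply: contrapT => nPz; apply: nQg => x fix_x.
have {fixVz} fix_z y : lt y z -> units P (g ^ y).
  by move=> yz; have := unitsV (fixVz y yz); rewrite conjVg invgK.
rewrite conjVg in nPz.
(* [g] fails at [x] and [g^-1] at [z]. The earlier of two distinct points is fixed by [g], so it
   cannot be a failure; if they coincide, totality of [P] is violated. *)
case: (lt3 x z) => [/fix_z[]//|->|/fix_x[_]//].
by case: (Ptot (g ^ z)).
Qed.

(** If [g] and [g^-1] both lie in the cone, [g] fixes each point once it fixes all earlier ones. *)
Lemma lex_cone_units (G : groupType) (lt : G -> G -> Prop) (P : set G) :
  well_founded lt -> units (lex_cone lt P) = unit_core P.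
Proof.
move=> lt_wf; apply/seteqP; split=> [g [Qg QVg] x|g Ng].
  elim/(well_founded_ind lt_wf): x => x IH; split; first exact/Qg/IH.
  by rewrite -conjVg; apply: QVg => y yx; rewrite conjVg; apply: unitsV (IH _ yx).
by split=> x _; rewrite ?conjVg; case: (Ng x).
Qed.

Definition unit_core_normal (G : groupType) (P : set G)
    (Pmul : subsemigroup P) (P1 : P 1) : normal_subgroup G.
Proof.
apply: (@NormalSubgroup G (unit_core P)).
- by move=> x; rewrite conj1g; split; rewrite ?invg1.
- by move=> g h Ng Nh x; rewrite conjMg; apply: unitsM.
- by move=> g Ng x; rewrite conjVg; apply: unitsV.
- move=> g k Ng x.
  (* Conjugating [g] only reindexes the family of its conjugates. *)
  by rewrite -[k in k * g]invgK -mulgA -[_ * _]/(g ^ k^-1) -conjgM.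
Defined.

(** The total preorder [Q (x^-1 * y)] is left-invariant and its equivalence classes are the cosets
    of [units Q], so it descends to an order on the quotient. *)
Lemma quotient_left_orderable (G : groupType) (N : normal_subgroup G)
    (Q : set G) :
  subsemigroup Q -> (forall x, Q x \/ Q x^-1) ->
  units Q = normal_subgroup_set N -> left_orderable (quotient_group N).
Proof.
move=> Qmul Qtot QN.
have QNP x y : reflect (units Q (x^-1 * y)) (same_coset N x y).
  by rewrite QN; apply: asboolP.
pose le (a b : quotient_group N) := `[< Q ((repr a)^-1 * repr b) >].
(* Changing representatives multiplies [x^-1 * y] on both sides by units of [Q]. *)
have leE x y : le (\pi_(quotient_group N) x) (\pi_(quotient_group N) y)
    <-> Q (x^-1 * y).
  rewrite /le; case: piP => x' /same_cosetP/QNP[Qx QVx].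
  case: piP => y' /same_cosetP/QNP[Qy QVy]; rewrite !invgM !invgK in QVx QVy.
  split=> [/asboolP Qxy|Qxy].
    have := Qmul _ _ (Qmul _ _ Qx Qxy) QVy.
    by rewrite !mulgA mulgK mulgK.
  apply/asboolP; have := Qmul _ _ (Qmul _ _ QVx Qxy) Qy.
  by rewrite !mulgA mulgK mulgK.
exists le; split.
- by move=> a; apply/asboolP; rewrite mulVg; apply: total_subsemigroup1.
- elim/quotW=> x; elim/quotW=> y /andP[/leE Qxy /leE Qyx].
  by apply/same_cosetP/QNP; split=> //; rewrite invgM invgK.
- elim/quotW=> y; elim/quotW=> x; elim/quotW=> z /leE Qxy /leE Qyz.
  by apply/leE; have := Qmul _ _ Qxy Qyz; rewrite -mulgA mulVKg.
- elim/quotW=> x; elim/quotW=> y; apply/orP.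
  case: (Qtot (x^-1 * y)) => [/leE|]; first by left.
  by rewrite invgM invgK => /leE; right.
- elim/quotW=> x; elim/quotW=> y; elim/quotW=> h.
  have mulE u v : \pi_(quotient_group N) u * \pi_(quotient_group N) v
      = \pi_(quotient_group N) (u * v) by apply: quotient_mulE.
  by rewrite !mulE; split=> /leE Qxy; apply/leE; move: Qxy;
    rewrite invgM -mulgA mulKg.
Qed.

Definition proper_subsemigroup_cover (G : groupType) (A B : set G) : Prop :=
  [/\ subsemigroup A, A <> setT, subsemigroup B, B <> setT & A `|` B = setT].

Lemma left_orderable_cover (G : groupType) :
  nontrivial G -> left_orderable G ->
  exists A B : set G, proper_subsemigroup_cover A B.
Proof.
move=> [a a1] [le [_ le_anti le_trans le_total leM]].
have leV x : le 1 x -> le x^-1 1 by move=> /(leM _ _ x^-1); rewrite mulg1 mulVg.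
have geV x : le x 1 -> le 1 x^-1 by move=> /(leM _ _ x^-1); rewrite mulg1 mulVg.
have anti1 x : le 1 x -> le x 1 -> x = 1.
  by move=> x_ge x_le; apply: le_anti; rewrite x_ge x_le.
exists [set x | le 1 x], [set x | le x 1]; split.
- move=> x y /= x_ge /(leM _ _ x); rewrite mulg1; exact: le_trans.
(* If every element were at least 1, applying this to [a^-1] would give [a <= 1], hence [a = 1]. *)
- move=> AT; have A_all x : le 1 x by have : [set: G] x by []; rewrite -AT.
  by apply/a1/anti1 => //; rewrite -[a]invgK; apply: leV.
- move=> x y /= x_le /(leM _ _ x); rewrite mulg1 => xy_le.
  exact: le_trans xy_le x_le.
- move=> BT; have B_all x : le x 1 by have : [set: G] x by []; rewrite -BT.
  by apply/a1/anti1 => //; rewrite -[a]invgK; apply: geV.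
- by apply/seteqP; split=> // x _; apply/orP; apply: le_total.
Qed.

Lemma preimage_cover (G H : groupType) (f : G -> H) (A B : set H) :
  {morph f : x y / x * y} -> (forall y, exists x, f x = y) ->
  proper_subsemigroup_cover A B ->
  proper_subsemigroup_cover (f @^-1` A) (f @^-1` B).
Proof.
move=> fM f_surj [Amul AT Bmul BT AB].
have properP C : C <> setT -> f @^-1` C <> setT.
  move=> CT fCT; apply: CT; apply/seteqP; split=> // y _.
  by have [x <-] := f_surj y; have : [set: G] x by []; rewrite -fCT.
split; try exact: properP.
- by move=> x y Ax Ay; rewrite /preimage /= fM; apply: Amul.
- by move=> x y Bx By; rewrite /preimage /= fM; apply: Bmul.
- by rewrite -preimage_setU AB preimage_setT.
Qed.

Lemma cover_total_subsemigroup (G : groupType) (A B : set G) :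
  subsemigroup A -> subsemigroup B -> A `|` B = setT ->
  (forall x, A x \/ A x^-1) \/ (forall x, B x \/ B x^-1).
Proof.
move=> Amul Bmul AB.
have AVB x : A x \/ B x by have : [set: G] x by []; rewrite -AB.
apply: contrapT => /not_orP[/existsNP[g /not_orP[nAg nAVg]]].
move=> /existsNP[h /not_orP[nBh nBVh]].
have [Bg BVg] : B g /\ B g^-1 by case: (AVB g) (AVB g^-1) => // ? [].
have [Ah AVh] : A h /\ A h^-1 by case: (AVB h) (AVB h^-1) => // ? [].
case: (AVB (g * h)) => [Agh|Bgh].
  by apply: nAg; rewrite -(mulgK h g); apply: Amul.
by apply: nBh; rewrite -(mulKg g h); apply: Bmul.
Qed.

Lemma total_subsemigroup_quotient (G : groupType) (P : set G) :
  subsemigroup P -> P <> setT -> (forall x, P x \/ P x^-1) ->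
  exists N : normal_subgroup G,
    nontrivial (quotient_group N) /\ left_orderable (quotient_group N).
Proof.
move=> Pmul PT Ptot; have P1 := total_subsemigroup1 Ptot.
have [lt [lt_wf lt_trans lt3]] := exists_strict_well_order G.
exists (unit_core_normal Pmul P1); split.
  have [x nPx] : exists x, ~ P x.
    by apply/existsNP => allP; apply: PT; apply/seteqP; split.
  (* Membership of [x] in the core, read at the conjugator 1, would put [x] in [P]. *)
  exists (\pi_(quotient_group _) x) => /esym/same_cosetP/asboolP /(_ 1).
  by rewrite conjg1 invg1 mul1g => -[/nPx].
apply: (@quotient_left_orderable _ _ (lex_cone lt P)).
- exact: lex_coneM.
- exact: lex_cone_total.
- exact: lex_cone_units.
Qed.

End GroupScope.

Theorem theorem1p3 (G : groupType) :
  (exists A B : set G,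
     [/\ subsemigroup A, A <> setT, subsemigroup B, B <> setT
       & A `|` B = setT])
  <->
  (exists N : normal_subgroup G,
     nontrivial (quotient_group N) /\ left_orderable (quotient_group N)).
Proof.
split=> [[A [B [Amul AT Bmul BT AB]]]|[N [N_nontriv N_lo]]].
  by case: (cover_total_subsemigroup Amul Bmul AB);
    apply: total_subsemigroup_quotient.
have [A [B ABcover]] := left_orderable_cover N_nontriv N_lo.
pose f : G -> quotient_group N := \pi_(quotient_group N)%qT.
exists (f @^-1` A), (f @^-1` B); apply: preimage_cover ABcover => [x y|].
  by rewrite /f -quotient_mulE.
by elim/quotW=> x; exists x.
Qed.
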